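(* Under the setup in the context, assume $m\ge2$ and that the randomization probabilities satisfy $I(\Theta;\tilde\Theta)\le I_0$ for some $I_0\ge0$. Then for every measurable estimator $\hat\Theta:\mathbb R^{T\times d}\to\{\theta_1,\dots,\theta_m\}$, $$\mathbb P\big(\Theta\neq\hat\Theta(\tilde Y_{1:T})\big)\ge\frac{H(\Theta)-I_0-1}{\log m},$$ where $H(\Theta)=-\sum_i p_i\log p_i$ is the entropy of $\Theta$ and all logarithms are base 2.
   Context: Let $T,d\ge 1$. The private parameter $\Theta$ is a random variable taking values in a finite set $\{\theta_1,\dots,\theta_m\}$ with $\mathbb P(\Theta=\theta_i)=p_i>0$. Let $\mathcal M=\{p_\theta\}_{\theta}$ be a family of joint probability densities on $\mathbb R^{T\times d}$ indexed by a parameter set containing $\theta_1,\dots,\theta_m$ and the pseudo-parameter values $\tilde\theta_1,\dots,\tilde\theta_{\tilde m}$. Conditioned on $\Theta=\theta_i$, the measurements $Y_1,\dots,Y_T$, with $Y_k=(Y_k^1,\dots,Y_k^d)^\top\in\mathbb R^d$, have joint p.d.f. $p_{\theta_i}(y_1,\dots,y_T)$; each $p_\theta$ is positive almost everywhere. Notation: $Y_{1:k}=(Y_1,\dots,Y_k)$, $Y_k^{1:l}=(Y_k^1,\dots,Y_k^l)$. For each parameter $\theta$ in the family, $k\in\{1,\dots,T\}$, $l\in\{1,\dots,d\}$, let $F_{l,k,\theta}(z\mid y_k^{1:l-1},y_{1:k-1})$ denote the conditional c.d.f. at $z$ of $Y_k^l$ given $Y_k^{1:l-1}=y_k^{1:l-1}$,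 $Y_{1:k-1}=y_{1:k-1}$ computed from $p_\theta$ (when $l=1$ or $k=1$ the corresponding empty conditioning is dropped). These conditional c.d.f.s are assumed absolutely continuous and strictly increasing in $z$, so that $F_{l,k,\theta}(\cdot\mid\cdot)$ is a bijection from $\mathbb R$ onto $(0,1)$ in its first argument; its inverse in the first argument is denoted $F^{-1}_{l,k,\theta}(\cdot\mid y_k^{1:l-1},y_{1:k-1})$. Randomizer: a pseudo parameter $\tilde\Theta$ takes values in $\{\tilde\theta_1,\dots,\tilde\theta_{\tilde m}\}$ with $\mathbb P(\tilde\Theta=\tilde\theta_j\mid\Theta=\theta_i)=P_{ji}$ ($P_{ji}\ge0$, $\sum_j P_{ji}=1$), and $\tilde\Theta$ is conditionally independent of $Y_{1:T}$ given $\Theta$. Nonlinear transformation: on $\{\Theta=\theta_i,\tilde\Theta=\tilde\theta_j\}$, define recursively for $k=1,\dots,T$ and, within each $k$, for $l=1,\dots,d$: $U_k^l=F_{l,k,\theta_i}(Y_k^l\mid Y_k^{1:l-1},Y_{1:k-1})$ and $\tilde Y_k^l=F^{-1}_{l,k,\tilde\theta_j}(U_k^l\mid \tilde Y_k^{1:l-1},\tilde Y_{1:k-1})$. The output is $\tilde Y_k=(\tilde Y_k^1,\dots,\tilde Y_k^d)^\top$. $I(\cdot;\cdot)$ denotes mutual information (base-2 logarithms). *)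

(* Defs.v *)
From HB Require Import structures.
From mathcomp Require Import all_boot all_order all_algebra.
From mathcomp Require Import all_classical all_reals all_analysis.
Set Implicit Arguments. Unset Strict Implicit. Unset Printing Implicit Defensive.
Import Order.TTheory GRing.Theory Num.Theory.
Local Open Scope classical_set_scope.
Local Open Scope ring_scope.

Section Defs.
Variable R : realType.

Definition log2 (x : R) : R := ln x / ln 2.

Definition entropy m (p : 'I_m -> R) : R := - \sum_(i < m) p i * log2 (p i).

(* Mutual information I(Theta; Theta~) of the discrete joint law
   P(Theta = i, Theta~ = j) = p_i * Pr j i  (Pr j i = P_{ji}).
   Terms with P_{ji} = 0 vanish (0 log 0 = 0 convention). *)
Definition mutual_info m mt (p : 'I_m -> R) (Pr : 'I_mt -> 'I_m -> R) : R :=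
  \sum_(i < m) \sum_(j < mt)
    p i * Pr j i * log2 (Pr j i / (\sum_(i' < m) p i' * Pr j i')).

Definition mk n (s : seq R) : n.-tuple R := [tuple nth 0 s i | i < n].

(* Iterated Lebesgue integral over R^n: integral w.r.t. n-dimensional
   Lebesgue measure of a nonnegative function (Tonelli). *)
Fixpoint iint (n : nat) : (n.-tuple R -> \bar R) -> \bar R :=
  match n return (n.-tuple R -> \bar R) -> \bar R with
  | 0 => fun f => f [tuple]
  | k.+1 => fun f =>
      (\int[@lebesgue_measure R]_x iint (fun t : k.-tuple R => f [tuple of x :: t]))%E
  end.

Definition marg n (p : n.-tuple R -> R) (x : seq R) : \bar R :=
  iint (fun r : (n - size x).-tuple R => (p (mk n (x ++ r)))%:E).

Definition abs_cont (f : R -> R) : Prop :=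
  forall e : R, 0 < e -> exists2 del : R, 0 < del &
    forall s : seq (R * R),
      (forall k, (k < size s)%N -> (nth (0,0) s k).1 <= (nth (0,0) s k).2) ->
      (forall k, (k.+1 < size s)%N -> (nth (0,0) s k).2 <= (nth (0,0) s k.+1).1) ->
      \sum_(ab <- s) (ab.2 - ab.1) < del ->
      \sum_(ab <- s) `|f ab.2 - f ab.1| < e.

Definition Finv (G : R -> R) (u : R) : R := xget 0 [set z | G z = u].

(* The nonlinear transformation, on the flattened coordinates
   c = k*d + l (row-major order: first over l within Y_k, then over k).
   F  : conditional cdf of the true parameter,
   Ft : conditional cdf of the pseudo parameter;
   both take the conditioning prefix (as a sequence) first. *)
Definition transf_step (F Ft : seq R -> R -> R) (y : seq R) (acc : seq R) : seq R :=
  let c := size acc in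
  rcons acc (Finv (Ft acc) (F (take c y) (nth 0 y c))).

Definition transf n (F Ft : seq R -> R -> R) (y : n.-tuple R) : n.-tuple R :=
  mk n (iter n (transf_step F Ft y) [::]).

End Defs.

(* Main.v *)
(* Conditionally on Theta = theta_i, the successive conditional c.d.f. values
   U = F_{theta_i}(Y) (the Rosenblatt transform) are i.i.d. uniform on [0, 1].
   The output is a fixed function of U and of the pseudo parameter, so
   P(Theta = i, Theta~ = j, estimate = k) = p_i P_ji q_jk with q independent of
   i.  For such a kernel, Fano's bound follows from the Gibbs inequality applied
   to the posterior of Theta given Theta~ = j and, for each estimate k, the
   guess giving mass 1/2 to k and 1/(2m) to every other value; no separate data
   processing inequality is needed. *)
Require Import Defs.
From HB Require Import structures.
From mathcomp Require Import all_boot all_order all_algebra.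
From mathcomp Require Import all_classical all_reals all_analysis.
From mathcomp Require Import measurable_realfun.
From mathcomp Require Import ring lra.
Import Order.TTheory GRing.Theory Num.Theory.
Local Open Scope classical_set_scope.
Local Open Scope ring_scope.

(** * Fano's inequality for a discrete kernel *)

(** Here [q j k] is the chance of guessing [k] given pseudo parameter [j], so the triple sum is the
    error probability. *)
Lemma fano_kernel (R : realType) (m mt : nat) (p : 'I_m -> R)
    (Pr : 'I_mt -> 'I_m -> R) (q : 'I_mt -> 'I_m -> R) :
  (0 < m)%N ->
  (forall i, 0 < p i) -> \sum_(i < m) p i = 1 ->
  (forall i j, 0 <= Pr j i) -> (forall i, \sum_(j < mt) Pr j i = 1) ->
  (forall j k, 0 <= q j k) -> (forall j, \sum_(k < m) q j k = 1) ->
  entropy p - mutual_info p Pr - 1 <=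
  log2 m%:R * \sum_(i < m) \sum_(j < mt) \sum_(k < m | k != i)
    p i * Pr j i * q j k.
Proof.
move=> m0 p0 sp Pr0 sPr q0 sq.
have l2 : 0 < ln 2 :> R by rewrite ln_gt0// ltr1n.
have mR : 0 < m%:R :> R by rewrite ltr0n.
pose s j := \sum_(i' < m) p i' * Pr j i'.
pose v (i k : 'I_m) : R := if k == i then 2^-1 else (2 * m%:R)^-1.
have s0 j : 0 <= s j by apply: sumr_ge0 => i _; rewrite mulr_ge0// ltW.
have v0 i k : 0 < v i k.
  by rewrite /v; case: ifP => _; rewrite invr_gt0// mulr_gt0.
(* Total mass at most 1 is enough for Gibbs; the off-diagonal weights are bounded by [m] copies of
   [1/(2m)], that is by 1/2. *)
have sv k : \sum_(i < m) v i k <= 1.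
  rewrite (bigD1 k)//= {1}/v eqxx.
  have : \sum_(i < m | i != k) v i k <= \sum_(i < m) (2 * m%:R)^-1.
    rewrite [leRHS](bigID (fun i => i == k))/=.
    rewrite big_pred1_eq ler_wpDl ?invr_ge0 ?mulr_ge0//.
    by apply: ler_sum => i ik; rewrite /v eq_sym (negbTE ik).
  rewrite sumr_const card_ord -[X in _ <= X -> _]mulr_natr invfM.
  rewrite -[X in _ <= X -> _]mulrA mulVf ?gt_eqF// mulr1.
  lra.
(* Termwise Gibbs: [a * ln (b / a) <= b - a] with [a = p i * Pr j i * q j k] and
   [b = s j * q j k * v i k], from [ln x <= x - 1]. If [Pr j i = 0], the left side is 0. *)
have gibbs i j k : p i * Pr j i * q j k *
    (- ln (p i) - ln (Pr j i / s j) - ln 2 - (k != i)%:R * ln m%:R) <=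
    s j * q j k * v i k - p i * Pr j i * q j k.
  have [->|Prn0] := eqVneq (Pr j i) 0.
    by rewrite mulr0 !mul0r subr0 mulr_ge0 ?mulr_ge0// ltW.
  have Prp : 0 < Pr j i by rewrite lt_neqAle eq_sym Prn0 Pr0.
  have sp0 : 0 < s j.
    rewrite /s (bigD1 i)//= ltr_pwDl ?mulr_gt0//.
    by apply: sumr_ge0 => i' _; rewrite mulr_ge0// ltW.
  have lv : ln (v i k) = - ln 2 - (k != i)%:R * ln m%:R.
    rewrite /v; case: eqVneq => _ /=; rewrite lnV ?posrE ?mulr_gt0//.
      by rewrite mul0r subr0.
    by rewrite lnM ?posrE// mul1r opprD.
  have -> : - ln (p i) - ln (Pr j i / s j) - ln 2 - (k != i)%:R * ln m%:R =
      ln (v i k * s j / (p i * Pr j i)).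
    by rewrite !lnM ?posrE ?invr_gt0 ?mulr_gt0// !lnV ?posrE ?mulr_gt0//
      lnM ?posrE// lv; ring.
  have -> : s j * q j k * v i k - p i * Pr j i * q j k =
      p i * Pr j i * q j k * (v i k * s j / (p i * Pr j i) - 1).
    by field; rewrite !gt_eqF.
  apply: ler_wpM2l; first by rewrite !mulr_ge0// ltW.
  rewrite -[X in ln X](subrKC 1) le_ln1Dx// ltrBrDl subrr.
  by rewrite !mulr_gt0 ?invr_gt0 ?mulr_gt0.
(* For fixed [j] the subtracted terms total exactly [s j]; summing the others over [i] first gives
   at most [s j] by [sv]. *)
have sum_le : \sum_(i < m) \sum_(j < mt) \sum_(k < m)
    (s j * q j k * v i k - p i * Pr j i * q j k) <= 0.
  rewrite exchange_big/=.
  under eq_bigr do rewrite exchange_big/=.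
  apply: sumr_le0 => j _.
  under eq_bigr do rewrite sumrB -mulr_sumr -mulr_suml.
  rewrite sumrB -[X in _ - X]mulr_sumr sq mulr1 subr_le0.
  rewrite -[leRHS]mulr1 -(sq j) mulr_sumr; apply: ler_sum => k _.
  by rewrite ler_piMr// mulr_ge0.
(* As [q j] sums to 1, only the [ln m] term still depends on the guess, through the error mass. *)
have inner i j : \sum_(k < m) p i * Pr j i * q j k *
    (- ln (p i) - ln (Pr j i / s j) - ln 2 - (k != i)%:R * ln m%:R) =
    Pr j i * (p i * (- ln (p i) - ln 2)) - p i * Pr j i * ln (Pr j i / s j) -
    ln m%:R * \sum_(k < m | k != i) p i * Pr j i * q j k.
  transitivity (\sum_(k < m) (p i * Pr j i *
      (- ln (p i) - ln (Pr j i / s j) - ln 2) * q j k -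
      ln m%:R * ((k != i)%:R * (p i * Pr j i * q j k)))).
    by apply: eq_bigr => k _; ring.
  rewrite sumrB -!mulr_sumr sq mulr1 [in RHS]big_mkcond/=.
  congr (_ - _); first by ring.
  congr (_ * _); rewrite mulr_sumr; apply: eq_bigr => k _.
  by case: eqP; rewrite ?mul0r ?mul1r ?mulr0.
have : \sum_(i < m) \sum_(j < mt) \sum_(k < m) p i * Pr j i * q j k *
    (- ln (p i) - ln (Pr j i / s j) - ln 2 - (k != i)%:R * ln m%:R) <= 0.
  by apply: le_trans sum_le; do 3! (apply: ler_sum => ? _).
under eq_bigr do under eq_bigr do rewrite inner.
under eq_bigr do rewrite !sumrB -mulr_suml sPr mul1r mulrBr mulrN -mulr_sumr.
rewrite !sumrB -mulr_sumr -mulr_suml sp mul1r sumrN => le0.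
(* Multiplying by [ln 2] passes from base 2 to natural logarithms. *)
rewrite -(ler_pM2r l2) !mulrBl mul1r.
have -> : entropy p * ln 2 = - \sum_(i < m) p i * ln (p i).
  rewrite /entropy mulNr mulr_suml; congr (- _); apply: eq_bigr => i _.
  by rewrite /log2 mulrA divfK// gt_eqF.
have -> : mutual_info p Pr * ln 2 =
    \sum_(i < m) \sum_(j < mt) p i * Pr j i * ln (Pr j i / s j).
  rewrite /mutual_info mulr_suml; apply: eq_bigr => i _.
  rewrite mulr_suml; apply: eq_bigr => j _.
  by rewrite /log2 mulrA divfK// gt_eqF.
rewrite mulrAC /log2 divfK ?gt_eqF//.
by rewrite -subr_le0 [X in X - _]addrAC.
Qed.

(** * Iterated integrals against a general measure *)

Section iterated_integral.
Context {R : realType}.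
Local Notation mR := (measurableTypeR R).

Section def.
Variable mu : set mR -> \bar R.
(** Generalizes [iint] to any [mu], since the transformed coordinates are integrated against the
    uniform law. *)
Fixpoint iter_integral {n : nat} : (n.-tuple R -> \bar R) -> \bar R :=
  match n with
  | 0 => fun f => f [tuple]
  | k.+1 => fun f =>
      (\int[mu]_x iter_integral (fun t : k.-tuple R => f [tuple of x :: t]))%E
  end.
End def.

Lemma iint_iter_integral n (f : n.-tuple R -> \bar R) :
  iint f = iter_integral lebesgue_measure f.
Proof.
elim: n f => [//|n IHn] f /=.
by apply: eq_integral => x _; exact: IHn.
Qed.

Variable mu : {sigma_finite_measure set mR -> \bar R}.

Lemma iter_integral_ge0 n (f : n.-tuple R -> \bar R) :
  (forall x, (0 <= f x)%E) -> (0 <= iter_integral mu f)%E.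
Proof.
elim: n f => [|n IHn] f f0 /=; first exact: f0.
by apply: integral_ge0 => x _; apply: IHn => t.
Qed.

(** Tonelli, one coordinate at a time. The parameter space [X] is general because the induction
    moves the outer integration variable into it. *)
Lemma measurable_iter_integral d (X : measurableType d) n
    (f : X -> n.-tuple R -> \bar R) :
  measurable_fun setT (fun xt : X * n.-tuple R => f xt.1 xt.2) ->
  (forall x t, (0 <= f x t)%E) ->
  measurable_fun setT (fun x => iter_integral mu (f x)).
Proof.
elim: n d X f => [|n IHn] d X f mf f0 /=.
  exact: (measurableT_comp mf
    (@pair2_measurable _ _ X _ ([tuple] : 0.-tuple R))).
apply: (@measurable_fun_fubini_tonelli_F _ _ X mR R mu (fun xs : X * mR =>
  iter_integral mu (fun t : n.-tuple R => f xs.1 [tuple of xs.2 :: t]))).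
  apply: (IHn _ (X * mR)%type
    (fun xs t => f xs.1 [tuple of xs.2 :: t])) => //.
  have mcons : measurable_fun setT (fun xst : (X * mR) * n.-tuple R =>
      (xst.1.1, [tuple of xst.1.2 :: xst.2])).
    apply: measurable_fun_pair => /=; first exact: measurableT_comp.
    by apply: measurable_cons => //; exact: measurableT_comp.
  exact: (measurableT_comp mf mcons).
by move=> xs; apply: iter_integral_ge0.
Qed.

End iterated_integral.

(** * Coordinates of tuples and measurability *)

Section coordinates.
Context {R : realType}.

Lemma nth_mk n (s : seq R) i : (i < n)%N -> nth 0 (mk n s) i = nth 0 s i.
Proof.
move=> ilt; rewrite /mk (nth_map (Ordinal ilt)) ?size_enum_ord//.
by congr nth; rewrite nth_enum_ord.
Qed.

Lemma mk_id n (t : n.-tuple R) : mk n t = t.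
Proof.
by apply: eq_from_tnth => i; rewrite tnth_mktuple (tnth_nth 0).
Qed.

Lemma mk_val n (s : seq R) : size s = n -> mk n s = s :> seq R.
Proof.
move=> sn; apply: (@eq_from_nth _ 0); first by rewrite size_tuple sn.
by move=> i; rewrite size_tuple => ilt; rewrite nth_mk.
Qed.

Lemma measurable_mk d (X : measurableType d) n (g : X -> seq R) :
  (forall i, (i < n)%N -> measurable_fun setT (fun x => nth 0 (g x) i)) ->
  measurable_fun setT (fun x => mk n (g x)).
Proof.
move=> mg; apply/measurable_fun_tnthP => i /=.
rewrite (_ : _ \o _ = fun x => nth 0 (g x) i); first exact: mg.
by apply/funext => x /=; rewrite tnth_mktuple.
Qed.

Lemma measurable_nth n i :
  measurable_fun setT (fun t : n.-tuple R => nth 0 t i).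
Proof.
have [ilt|nle] := ltnP i n.
  rewrite (_ : (fun _ => _) = fun t => tnth t (Ordinal ilt)).
    exact: measurable_tnth.
  by apply/funext => t; rewrite (tnth_nth 0).
rewrite (_ : (fun _ => _) = cst 0); first exact: measurable_cst.
by apply/funext => t; rewrite nth_default// size_tuple.
Qed.

End coordinates.

(** * Transport of a density by its distribution function *)

Section transport.
Context {R : realType}.
Local Open Scope ereal_scope.
Local Notation mR := (measurableTypeR R).
Local Notation lambda := (@lebesgue_measure R).
Local Notation U01 := (uniform_prob (@ltr01 R)).

Lemma uniform_prob01_ray (u : R) :
  U01 `]-oo, u[%classic = (Num.min 1 (Num.max 0 u))%:E.
Proof.
have mray : measurable (`]-oo, u[%classic : set mR) by exact: measurable_itv.
rewrite -(setIT `]-oo, u[%classic) -integral_indic//.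
rewrite integral_uniform//; last first.
  exact/measurable_EFinP/measurable_indic.
rewrite subr0 invr1 mul1e integral_indic//.
have [u0|u0] := leP u 0%R.
  rewrite (_ : _ `&` _ = set0) ?measure0.
    by rewrite min_r.
  rewrite -subset0 => x /= []; rewrite !in_itv/= => xu /andP[x0 _].
  by have := lt_le_trans xu u0; rewrite ltNge x0.
have [u1|u1] := ltP 1%R u.
  rewrite (_ : _ `&` _ = `[0%R, 1%R]%classic).
    rewrite [LHS](lebesgue_measure_itv `[0%R, 1%R])/= lte_fin ltr01.
    by rewrite oppr0 adde0.
  apply/seteqP; split=> x /=; first by case.
  rewrite !in_itv/= => /andP[x0 x1]; rewrite x0 x1; split=> //.
  exact: le_lt_trans u1.
rewrite (_ : _ `&` _ = `[0%R, u[%classic).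
  by rewrite [LHS](lebesgue_measure_itv `[0%R, u[)/= lte_fin u0 oppr0 adde0.
apply/seteqP; split=> x /=; rewrite !in_itv/=.
  by case=> -> /andP[->].
by move=> /andP[x0 xu]; rewrite x0 xu (ltW (lt_le_trans xu u1)).
Qed.

(** Open rays form a pi-system generating the Borel sets, and countably many of them, of finite
    measure, cover the line. *)
Lemma measure_unique_rays (m1 m2 : {measure set mR -> \bar R}) :
  (forall u : R, m1 `]-oo, u[%classic = m2 `]-oo, u[%classic) ->
  (forall u : R, m1 `]-oo, u[%classic < +oo) ->
  forall A, measurable A -> m1 A = m2 A.
Proof.
move=> m12 m1oo.
apply: (@measure_unique _ R mR (@RGenInftyO.G R)
  (fun k => `]-oo, k%:R[%classic) _ _ _ _ m1 m2).
- exact: RGenInftyO.measurableE.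
- move=> _ _ [x ->] [y ->]; exists (Num.min x y).
  by apply/seteqP; split => z /=; rewrite !in_itv/= lt_min => /andP.
- by move=> k; exists k%:R.
- rewrite -subTset => x _; exists (Num.bound `|x|) => //=.
  by rewrite in_itv/= (le_lt_trans (ler_norm x))// archi_boundP.
- by move=> _ [u ->].
- by move=> k; exact: m1oo.
Qed.

Variables (h : mR -> \bar R) (mh : measurable_fun setT h).
Hypothesis h0 : forall t, 0 <= h t.
Hypothesis hoo : \int[lambda]_t h t < +oo.

Let nu (A : set mR) : \bar R := \int[lambda]_(t in A) h t.

Let nu_set0 : nu set0 = 0. Proof. exact: integral_set0. Qed.
Let nu_ge0 A : 0 <= nu A. Proof. exact: integral_ge0. Qed.
Let nu_sigma_additive : semi_sigma_additive nu.
Proof. exact: semi_sigma_additive_nng_induced. Qed.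

HB.instance Definition _ := isMeasure.Build _ _ _ nu
  nu_set0 nu_ge0 nu_sigma_additive.

Let nu_fin : fin_num_fun nu.
Proof.
move=> A mA; rewrite ge0_fin_numE//; apply: le_lt_trans hoo.
exact: ge0_subset_integral.
Qed.

HB.instance Definition _ := Measure_isFinite.Build _ _ _ nu nu_fin.

(** The Radon-Nikodym derivative of [nu] and [h] have equal integrals over every measurable set,
    hence agree almost everywhere, and change of variables carries over to [h]. *)
Lemma integral_density (g : mR -> \bar R) :
  measurable_fun setT g -> (forall t, 0 <= g t) ->
  \int[lambda]_t (g t * h t) = \int[nu]_t g t.
Proof.
move=> mg g0.
have nulambda : nu `<< lambda.
  apply/null_content_dominatesP => A mA A0.
  by apply: null_set_integral => //; exact: measurable_funTS.
rewrite -(Radon_Nikodym_SigmaFinite.change_of_variables nulambda)//.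
have mf : measurable_fun setT (Radon_Nikodym_SigmaFinite.f nu lambda).
  apply: measurable_int; exact: Radon_Nikodym_SigmaFinite.f_integrable.
apply: ge0_ae_eq_integral => //.
- exact: emeasurable_funM.
- exact: emeasurable_funM.
- by move=> t _; rewrite mule_ge0.
- by move=> t _; rewrite mule_ge0// Radon_Nikodym_SigmaFinite.f_ge0.
have : ae_eq lambda setT h (Radon_Nikodym_SigmaFinite.f nu lambda).
  apply: integral_ae_eq => //.
    apply/integrableP; split=> //.
    by under eq_integral do rewrite gee0_abs//.
  by move=> A _ mA; rewrite -Radon_Nikodym_SigmaFinite.f_integral.
by apply: filterS => t /= hf _; rewrite hf.
Qed.

Variable F : mR -> mR.
Hypothesis mF : measurable_fun setT F.
Hypothesis F_incr : forall z1 z2, (z1 < z2)%R -> (F z1 < F z2)%R.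
Hypothesis F01 : forall z, (0 < F z < 1)%R.
Hypothesis F_surj : forall u, (0 < u < 1)%R -> exists z, F z = u.
(** Guarded by positive mass because a prefix of zero marginal density leaves its conditional c.d.f.
    unconstrained. *)
Hypothesis F_cdf : 0 < \int[lambda]_t h t -> forall z,
  (F z)%:E * \int[lambda]_t h t = \int[lambda]_(t in `]-oo, z]) h t.

(* F pushes the measure of density h forward to a multiple of the uniform law. *)
Lemma integral_cdf_transport (g : mR -> \bar R) :
  measurable_fun setT g -> (forall t, 0 <= g t) ->
  \int[lambda]_t (g (F t) * h t) =
  \int[lambda]_t h t * \int[U01]_u g u.
Proof.
move=> mg g0.
rewrite (integral_density (g \o F) (measurableT_comp mg mF) (fun=> g0 _)).
have [Hoo Fcdf] := (hoo, F_cdf).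
set H := \int[lambda]_t h t in Hoo Fcdf *.
have H0 : 0 <= H by exact: integral_ge0.
have Hfin : H \is a fin_num by rewrite ge0_fin_numE.
have fH0 : (0 <= fine H)%R by exact: fine_ge0.
rewrite (_ : \int[nu]_t g (F t) = \int[pushforward nu F]_u g u); last first.
  by rewrite ge0_integral_pushforward.
have rays : forall A, measurable A ->
    pushforward nu F A = mscale (NngNum fH0) U01 A.
  apply: measure_unique_rays => u; last first.
    apply: le_lt_trans Hoo; rewrite -[leLHS]/(nu (F @^-1` `]-oo, u[%classic)).
    apply: ge0_subset_integral => //.
    by rewrite -[X in measurable X]setTI; apply: mF.
  transitivity ((fine H)%:E * U01 `]-oo, u[%classic); last by [].
  rewrite uniform_prob01_ray fineK// -[LHS]/(nu (F @^-1` `]-oo, u[%classic)).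
  have [u0|u0] := leP u 0%R.
    rewrite (_ : _ @^-1` _ = set0) ?measure0 ?min_r ?mule0//.
    rewrite -subset0 => z /=; rewrite in_itv/= => Fzu.
    by have /andP[+ _] := F01 z; rewrite ltNge (ltW (lt_le_trans Fzu u0)).
  have [u1|u1] := leP 1%R u.
    rewrite mule1 (_ : _ @^-1` _ = setT)//.
    rewrite -subTset => z _ /=; rewrite in_itv/=.
    by have /andP[_ /lt_le_trans] := F01 z; exact.
  have [|z Fz] := F_surj u; first exact/andP.
  (* Strict monotonicity turns the ray at [u = F z] into the ray at [z]; its endpoint is
     Lebesgue-null, so [F_cdf] for the closed ray applies. *)
  rewrite (_ : F @^-1` _ = `]-oo, z[%classic); last first.
    apply/seteqP; split=> t /=; rewrite !in_itv/= -Fz.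
      apply: contraTT; rewrite -!leNgt le_eqVlt.
      by move=> /predU1P[->//|/F_incr/ltW].
    exact: F_incr.
  rewrite /nu integral_itv_bndo_bndc; last exact: measurable_funTS.
  (* [F_cdf] is silent when the total mass [H] is 0, but then both sides vanish. *)
  have [HE|Hn] := eqVneq H 0%R; last first.
    by rewrite -Fcdf ?Fz 1?muleC// lt_neqAle eq_sym Hn.
  rewrite HE mul0e; apply/eqP; rewrite eq_le integral_ge0// andbT -HE.
  exact: ge0_subset_integral.
transitivity (\int[mscale (NngNum fH0) U01]_u g u).
  by apply: eq_measure_integral => A mA _; exact: rays.
by rewrite ge0_integral_mscale//= fineK.
Qed.
End transport.

(** * The Rosenblatt transform and its inverse *)

Section rosenblatt_def.
Context {R : realType}.

(** Defined on sequences of any length, so that prefixes can be transformed as well. *)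
Definition rosenblatt (G : seq R -> R -> R) (x : seq R) : seq R :=
  mkseq (fun c => G (take c x) (nth 0 x c)) (size x).

Definition rosenblatt_inv_step (Ft : seq R -> R -> R) (u acc : seq R) : seq R :=
  rcons acc (Finv (Ft acc) (nth 0 u (size acc))).

Definition rosenblatt_inv n (Ft : seq R -> R -> R) (u : n.-tuple R) :
    n.-tuple R :=
  mk n (iter n (rosenblatt_inv_step Ft u) [::]).

(** Coordinate [c] of the transform reads only the first [c.+1] entries. *)
Lemma rosenblatt_rcons G x t :
  rosenblatt G (rcons x t) = rcons (rosenblatt G x) (G x t).
Proof.
rewrite /rosenblatt size_rcons mkseqS -[rcons x t]cats1 take_size_cat//.
rewrite nth_cat ltnn subnn /=; congr rcons.
apply/eq_in_map => c; rewrite mem_iota add0n => /= cx.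
by rewrite takel_cat 1?ltnW// nth_cat cx.
Qed.

Lemma size_rosenblatt_inv_step Ft u k :
  size (iter k (rosenblatt_inv_step Ft u) [::]) = k.
Proof. by elim: k => [//|k IHk] /=; rewrite size_rcons IHk. Qed.

(** The true parameter enters the output only through the Rosenblatt coordinates; the outer map
    depends on the pseudo parameter alone. *)
Lemma transf_rosenblatt n F Ft (y : n.-tuple R) :
  transf F Ft y = rosenblatt_inv n Ft (mk n (rosenblatt F y)).
Proof.
congr mk; suff: forall k, (k <= n)%N -> iter k (transf_step F Ft y) [::] =
    iter k (rosenblatt_inv_step Ft (mk n (rosenblatt F y))) [::] by exact.
elim=> [//|k IHk] kn /=.
rewrite IHk 1?ltnW// /rosenblatt_inv_step /transf_step.
congr (rcons _ (Finv _ _)).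
by rewrite size_rosenblatt_inv_step nth_mk// nth_mkseq ?size_tuple.
Qed.

End rosenblatt_def.

(** * Measurability of the transform and of its inverse *)

Section rosenblatt_measurable.
Context {R : realType} (n : nat) (G : seq R -> R -> R).
Hypothesis mG : forall c : nat,
  measurable_fun setT (fun xz : c.-tuple R * R => G (tval xz.1) xz.2).
Hypothesis G_incr : forall x z1 z2, z1 < z2 -> G x z1 < G x z2.
Hypothesis G01 : forall x z, 0 < G x z < 1.
Hypothesis G_surj : forall x u, 0 < u < 1 -> exists z, G x z = u.

Lemma measurable_cond_cdf x : measurable_fun setT (G x).
Proof.
have -> : G x = (fun xz => G (tval xz.1) xz.2) \o (pair (in_tuple x)) by [].
apply: measurableT_comp (mG (size x)) _.
exact: pair1_measurable.
Qed.

Lemma measurable_rosenblatt :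
  measurable_fun setT (fun y : n.-tuple R => mk n (rosenblatt G y)).
Proof.
apply: measurable_mk => i ilt.
rewrite (_ : (fun _ => _) = (fun xz => G (tval xz.1) xz.2) \o
    (fun y : n.-tuple R => (mk i (take i y), nth 0 y i))); last first.
  apply/funext => y /=; rewrite nth_mkseq ?size_tuple// mk_val//.
  by rewrite size_takel// size_tuple ltnW.
apply: measurableT_comp (mG i) _.
apply: measurable_fun_pair; last exact: measurable_nth.
apply: measurable_mk => j jlt.
rewrite (_ : (fun _ => _) = fun y : n.-tuple R => nth 0 y j).
  exact: measurable_nth.
by apply/funext => y; rewrite nth_take.
Qed.

Lemma FinvK x u : 0 < u < 1 -> G x (Finv (G x) u) = u.
Proof. by move=> /(G_surj x) u01; exact: xgetPex u01. Qed.

(** [G x] takes values in (0, 1), so there is no root and [xget] returns its default 0. *)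
Lemma Finv_notin x u : ~ 0 < u < 1 -> Finv (G x) u = 0.
Proof. by move=> u01; apply: xgetPN => z; apply: contra_not u01 => <-. Qed.

Lemma cond_cdf_lt x z1 z2 : (G x z1 < G x z2) = (z1 < z2).
Proof.
by apply/idP/idP => [|/G_incr//]; apply: contraTT; rewrite -!leNgt le_eqVlt
  => /predU1P[->//|/(G_incr x)/ltW].
Qed.

(** For [0 < u < 1], [Finv (G x) u < z] means [u < G x z], a jointly measurable condition on
    [(x, u)]. *)
Lemma measurable_Finv c :
  measurable_fun setT (fun xu : c.-tuple R * R => Finv (G (tval xu.1)) xu.2).
Proof.
pose S := (fun xu : c.-tuple R * R => xu.2) @^-1` `]0, 1[%classic.
have mS : measurable S.
  by rewrite -[S]setTI; apply: measurable_snd => //; exact: measurable_itv.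
pose L z := (fun xu : c.-tuple R * R => xu.2 - G (tval xu.1) z) @^-1`
  `]-oo, 0[%classic.
have mL z : measurable (L z).
  have mf : measurable_fun setT
      (fun xu : c.-tuple R * R => xu.2 - G (tval xu.1) z).
    apply: measurable_funB => //.
    apply: (measurableT_comp (mG c) (g := fun xu => (xu.1, z))).
    exact: measurable_fun_pair.
  by rewrite -[L z]setTI; apply: mf => //; exact: measurable_itv.
apply: (measurability _ (RGenInftyO.measurableE R)) => // _ [_ [z ->] <-].
(* The second piece is where the default 0 is taken: it counts in full if [0 < z] and not at all
   otherwise. *)
rewrite setTI (_ : _ @^-1` _ =
    (S `&` L z) `|` (~` S `&` (if 0 < z then setT else set0))).
  apply: measurableU; apply: measurableI => //; first exact: measurableC.
  by case: ifP => _.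
apply/seteqP; split => -[x u] /=; rewrite /S /L /= !in_itv/= subr_lt0.
  have [u01|u01] := boolP (0 < u < 1).
    by move=> uz; left; split => //; rewrite -[ltLHS](FinvK x u)// cond_cdf_lt.
  by rewrite Finv_notin; [move=> ->; right|exact/negP].
move=> [[u01]|[u01]].
  by rewrite -[ltLHS](FinvK x u)// cond_cdf_lt.
by rewrite Finv_notin//; case: ifP.
Qed.

Lemma measurable_rosenblatt_inv : measurable_fun setT (rosenblatt_inv n G).
Proof.
(* Induction on the prefix length: the new coordinate is [Finv] at the prefix already built and the
   next entry of [u]. *)
suff: forall k, (k <= n)%N -> measurable_fun setT (fun u : n.-tuple R =>
    mk k (iter k (rosenblatt_inv_step G u) [::])) by exact.
elim=> [|k IHk] kn.
  by apply: measurable_mk => i; rewrite ltn0.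
apply: measurable_mk => i; rewrite ltnS leq_eqVlt => /predU1P[->|ik] /=.
  rewrite (_ : (fun _ => _) = (fun xu => Finv (G (tval xu.1)) xu.2) \o
      (fun u : n.-tuple R => (mk k (iter k (rosenblatt_inv_step G u) [::]),
                              nth 0 u k))); last first.
    apply/funext => u /=; rewrite nth_rcons size_rosenblatt_inv_step ltnn eqxx.
    by rewrite mk_val// size_rosenblatt_inv_step.
  apply: measurableT_comp (measurable_Finv k) _.
  by apply: measurable_fun_pair; [exact: IHk (ltnW kn)|exact: measurable_nth].
rewrite (_ : (fun _ => _) = (fun t : k.-tuple R => nth 0 t i) \o
    (fun u : n.-tuple R => mk k (iter k (rosenblatt_inv_step G u) [::]))).
  exact: measurableT_comp (measurable_nth k i) (IHk (ltnW kn)).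
by apply/funext => u /=; rewrite nth_rcons size_rosenblatt_inv_step ik nth_mk.
Qed.

End rosenblatt_measurable.

(** * Uniformity of the Rosenblatt coordinates *)

Section rosenblatt_uniform.
Context {R : realType} (n : nat) (p : n.-tuple R -> R) (G : seq R -> R -> R).
Local Notation U01 := (uniform_prob (@ltr01 R)).
Local Notation lambda := (@lebesgue_measure R).
Hypothesis mp : measurable_fun setT p.
Hypothesis p0 : forall y, 0 <= p y.
Hypothesis G_cdf : forall (x : seq R) z, (size x < n)%N ->
  (0 < marg p x < +oo)%E ->
  ((G x z)%:E * marg p x =
     \int[lambda]_(t in `]-oo, z]) marg p (rcons x t))%E.
Hypothesis mG : forall c : nat,
  measurable_fun setT (fun xz : c.-tuple R * R => G (tval xz.1) xz.2).
Hypothesis G_incr : forall x z1 z2, z1 < z2 -> G x z1 < G x z2.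
Hypothesis G01 : forall x z, 0 < G x z < 1.
Hypothesis G_surj : forall x u, 0 < u < 1 -> exists z, G x z = u.

(** Frees the tuple length from the expression [n - size x], so that induction on [k] is
    possible. *)
Lemma margE k x : (size x + k = n)%N ->
  marg p x = iint (fun r : k.-tuple R => (p (mk n (x ++ r)))%:E).
Proof.
move=> xk; rewrite /marg; have -> // : (n - size x = k)%N.
by rewrite -xk addKn.
Qed.

Lemma measurable_mk_rcons k (x : seq R) :
  measurable_fun setT (fun tr : R * k.-tuple R => mk n (rcons x tr.1 ++ tr.2)).
Proof.
apply: measurable_mk => i _; have [ix|xi|->] := ltngtP i (size x).
- rewrite (_ : (fun _ => _) = cst (nth 0 x i)); first exact: measurable_cst.
  by apply/funext => tr; rewrite cat_rcons nth_cat ix.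
- rewrite (_ : (fun _ => _) =
      (fun r : k.-tuple R => nth 0 r (i - (size x).+1)) \o snd).
    exact: measurableT_comp (measurable_nth _ _) _.
  by apply/funext => tr /=; rewrite nth_cat size_rcons ltnNge xi.
- rewrite (_ : (fun _ => _) = fst)//.
  by apply/funext => tr; rewrite cat_rcons nth_cat ltnn subnn.
Qed.

Lemma measurable_iter_integral_rcons
    (mu : {sigma_finite_measure set (measurableTypeR R) -> \bar R}) k (x : seq R) (f : n.-tuple R -> \bar R) :
  measurable_fun setT f -> (forall y, (0 <= f y)%E) ->
  measurable_fun setT (fun t => iter_integral mu
    (fun r : k.-tuple R => f (mk n (rcons x t ++ r)))).
Proof.
move=> mf f0; apply: (@measurable_iter_integral _ mu _ R k
  (fun t (r : k.-tuple R) => f (mk n (rcons x t ++ r)))) => //.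
exact: measurableT_comp mf (measurable_mk_rcons k x).
Qed.

(* Induction on the number k of coordinates left to integrate; prefixes whose
   marginal density is infinite form a null set at each step. *)
Lemma iint_rosenblatt k x (f : n.-tuple R -> \bar R) : (size x + k = n)%N ->
  measurable_fun setT f -> (forall y, (0 <= f y)%E) -> (marg p x < +oo)%E ->
  (iint (fun r : k.-tuple R =>
     f (mk n (rosenblatt G (x ++ r))) * (p (mk n (x ++ r)))%:E) =
   marg p x *
     iter_integral U01
       (fun s : k.-tuple R => f (mk n (rosenblatt G x ++ s))))%E.
Proof.
move=> + mf f0.
elim: k x => [|k IHk] x xk xoo.
  by rewrite (margE 0%N)//= !cats0 muleC.
have xtk t : (size (rcons x t) + k = n)%N by rewrite size_rcons addSnnS.
have mpE : measurable_fun setT (fun y => (p y)%:E) by exact/measurable_EFinP.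
have hE t : marg p (rcons x t) = iter_integral lambda
    (fun r : k.-tuple R => (p (mk n (rcons x t ++ r)))%:E).
  by rewrite (margE k _ (xtk t)) iint_iter_integral.
have h0 t : (0 <= marg p (rcons x t))%E.
  by rewrite hE; apply: iter_integral_ge0 => r; rewrite lee_fin.
have mh : measurable_fun setT (fun t => marg p (rcons x t)).
  under eq_fun do rewrite hE.
  apply: (measurable_iter_integral_rcons lambda k x _ mpE) => y.
  by rewrite lee_fin.
have xE : marg p x = (\int[lambda]_t marg p (rcons x t))%E.
  rewrite (margE k.+1 _ xk) /=; apply: eq_integral => t _.
  rewrite (margE k _ (xtk t)); congr iint.
  by apply/funext => r; rewrite cat_rcons.
(* [g u] averages over the later coordinates, taken uniform, once the current one equals [u]. *)
pose g u := iter_integral U01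
  (fun s : k.-tuple R => f (mk n (rcons (rosenblatt G x) u ++ s))).
have mg : measurable_fun setT g.
  exact: (measurable_iter_integral_rcons U01 k (rosenblatt G x) f mf f0).
have g0 u : (0 <= g u)%E by exact: iter_integral_ge0.
pose phi (y : n.-tuple R) := (f (mk n (rosenblatt G y)) * (p y)%:E)%E.
have mphi : measurable_fun setT phi.
  apply: emeasurable_funM => //.
  exact: measurableT_comp mf (measurable_rosenblatt _ _ mG).
have phi0 y : (0 <= phi y)%E by rewrite mule_ge0// lee_fin.
have phiE t (r : k.-tuple R) : (f (mk n (rosenblatt G (rcons x t ++ r))) *
    (p (mk n (rcons x t ++ r)))%:E)%E = phi (mk n (rcons x t ++ r)).
  by rewrite /phi mk_val// size_cat size_tuple.
(* The middle term links two steps: [G x] makes the current coordinate uniform under the density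
   [marg p (rcons x t)] of mass [marg p x], and the induction hypothesis treats the later ones. *)
transitivity (\int[lambda]_t (g (G x t) * marg p (rcons x t)))%E; last first.
  rewrite (integral_cdf_transport _ mh h0 _ (G x))//.
  - rewrite -xE; congr (_ * _)%E; apply: eq_integral => u _.
    by congr iter_integral; apply/funext => s; rewrite cat_rcons.
  - by rewrite -xE.
  - exact: measurable_cond_cdf.
  - exact: G_incr.
  - exact: G_surj.
  - rewrite -xE => xp z; apply: G_cdf; last by rewrite xp xoo.
    by rewrite -xk addnS ltnS leq_addr.
rewrite /=; apply: ge0_ae_eq_integral => //.
- under eq_fun do under [X in iint X]eq_fun do rewrite -cat_rcons phiE.
  under eq_fun do rewrite iint_iter_integral.
  exact: (measurable_iter_integral_rcons lambda k x phi mphi phi0).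
- apply: emeasurable_funM => //.
  exact: measurableT_comp mg (measurable_cond_cdf G mG x).
- move=> t _; rewrite iint_iter_integral; apply: iter_integral_ge0 => r.
  by rewrite mule_ge0// lee_fin.
- by move=> t _; rewrite mule_ge0.
have : {ae lambda, forall t, setT t -> marg p (rcons x t) \is a fin_num}.
  apply: integrable_ae => //; apply/integrableP; split => //.
  by under eq_integral do rewrite gee0_abs//; rewrite -xE.
apply: (@filterS _ _ (ae_filter_ringOfSetsType lambda)) => t /= /(_ I) hfin _.
have := IHk (rcons x t) (xtk t); rewrite -ge0_fin_numE// => /(_ hfin).
rewrite rosenblatt_rcons muleC => <-; congr iint; apply/funext => r.
by rewrite cat_rcons.
Qed.

End rosenblatt_uniform.

(** * Finite partitions by a random index *)

Section level_sets.
Context {d} {T : measurableType d} {m : nat} (X : T -> 'I_m).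

Lemma level_setsE A : A = \big[setU/set0]_(i < m) (A `&` [set w | X w = i]).
Proof.
rewrite -bigcup_seq; apply/seteqP; split=> w /=.
  by move=> Aw; exists (X w) => //=; rewrite mem_index_enum.
by case=> i _ [].
Qed.

(** Serves for the error event, whose pieces become explicit once the parameters and the estimate
    are fixed. *)
Lemma measurable_level_sets A :
  (forall i, measurable (A `&` [set w | X w = i])) -> measurable A.
Proof. by move=> mA; rewrite (level_setsE A); apply: bigsetU_measurable. Qed.

Lemma measure_level_sets {R : realType} (P : probability T R) A :
  (forall i, measurable (A `&` [set w | X w = i])) ->
  P A = (\sum_(i < m) P (A `&` [set w | X w = i]))%E.
Proof.
move=> mA; rewrite [in LHS](level_setsE A) measure_bigsetU_ord//.
apply/trivIsetP => i j _ _; apply: contraNeq.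
by move=> /set0P[w [[_ /= <-] [_ /= <-]]].
Qed.

End level_sets.

Lemma mule_EFin_eq {R : realFieldType} {a b : R} {x : \bar R} : a != 0 ->
  (a%:E * x = b%:E)%E -> x = (b / a)%:E.
Proof.
move=> a0 axb.
by rewrite mulrC EFinM -axb muleA -EFinM mulVf// mul1e.
Qed.

(** * The error bound for the transformed measurements *)

Theorem theorem3
  (R : realType) (T d m mt : nat)
  (* the parameter set of the family and the family of densities on R^(T*d)
     (points of R^{T x d} flattened row-major: Y_k^l is coordinate k*d+l) *)
  (Par : Type) (dens : Par -> (T * d).-tuple R -> R)
  (* conditional c.d.f.s: F th x z = F_{l,k,th}(z | prefix x), where the
     prefix x lists the previous coordinates (size x = k*d + l) *)
  (F : Par -> seq R -> R -> R)
  (theta : 'I_m -> Par) (ttheta : 'I_mt -> Par)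
  (p : 'I_m -> R) (Pr : 'I_mt -> 'I_m -> R) (I0 : R)
  (* probability space and random variables *)
  (dO : measure_display) (Omega : measurableType dO) (P : probability Omega R)
  (Th : Omega -> 'I_m) (Tht : Omega -> 'I_mt) (Y : Omega -> (T * d).-tuple R)
  (Thhat : (T * d).-tuple R -> 'I_m) :
  (1 <= T)%N -> (1 <= d)%N -> (2 <= m)%N ->
  injective theta -> injective ttheta ->
  (* the prior of Theta *)
  (forall i, 0 < p i) -> \sum_(i < m) p i = 1 ->
  (* the randomization probabilities *)
  (forall i j, 0 <= Pr j i) -> (forall i, \sum_(j < mt) Pr j i = 1) ->
  (* each p_theta is a probability density on R^(T*d), positive a.e. *)
  (forall th, measurable_fun setT (dens th)) ->
  (forall th y, (0 <= dens th y)%R) ->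
  (forall th, iint (fun y => (dens th y)%:E) = 1%E) ->
  (forall th, iint (fun y => ((dens th y <= 0)%R%:R)%:E) = 0%E) ->
  (* F th is (a version of) the conditional c.d.f. computed from p_th *)
  (forall th (x : seq R) z, (size x < T * d)%N ->
     (0 < marg (dens th) x < +oo)%E ->
     ((F th x z)%:E * marg (dens th) x =
        \int[@lebesgue_measure R]_(t in `]-oo, z]) marg (dens th) (rcons x t))%E) ->
  (forall th (c : nat),
     measurable_fun setT (fun xz : c.-tuple R * R => F th (tval xz.1) xz.2)) ->
  (* absolutely continuous, strictly increasing, bijection R -> (0,1) *)
  (forall th x, abs_cont (F th x)) ->
  (forall th x z1 z2, z1 < z2 -> F th x z1 < F th x z2) ->
  (forall th x z, 0 < F th x z < 1) ->
  (forall th x u, 0 < u < 1 -> exists z, F th x z = u) ->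
  (* measurability of the random variables *)
  (forall i, measurable [set w | Th w = i]) ->
  (forall j, measurable [set w | Tht w = j]) ->
  measurable_fun setT Y ->
  (* P(Theta = theta_i) = p_i *)
  (forall i, P [set w | Th w = i] = (p i)%:E) ->
  (* P(Theta~ = theta~_j | Theta = theta_i) = P_ji *)
  (forall i j, P ([set w | Th w = i] `&` [set w | Tht w = j]) = (p i * Pr j i)%:E) ->
  (* conditioned on Theta = theta_i, Y_{1:T} has joint density p_{theta_i} *)
  (forall i (A : set ((T * d).-tuple R)), measurable A ->
     P ([set w | Th w = i] `&` (Y @^-1` A)) =
       ((p i)%:E * iint (fun y => (\1_A y * dens (theta i) y)%:E))%E) ->
  (* Theta~ conditionally independent of Y given Theta *)
  (forall i j (A : set ((T * d).-tuple R)), measurable A ->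
     (P ([set w | Th w = i] `&` [set w | Tht w = j] `&` (Y @^-1` A))
        * P [set w | Th w = i] =
      P ([set w | Th w = i] `&` [set w | Tht w = j])
        * P ([set w | Th w = i] `&` (Y @^-1` A)))%E) ->
  (* information constraint on the randomizer *)
  0 <= I0 -> mutual_info p Pr <= I0 ->
  (* measurable estimator *)
  (forall i, measurable (Thhat @^-1` [set i])) ->
  (((entropy p - I0 - 1) / log2 m%:R)%:E <=
     P [set w | Th w != Thhat
          (transf (F (theta (Th w))) (F (ttheta (Tht w))) (Y w))])%E.
Proof.
move=> T1 d1 m2 _ _ p0 sp Pr0 sPr mdens dens0 dens1 _ Fcdf mF _ Fincr F01 Fsurj.
move=> mTh mTht mY PTh PThTht PThY Pindep _ I0ge mThhat.
set n := (T * d)%N in dens Y Thhat mdens dens0 dens1 Fcdf mY PThY Pindep mThhat *.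
(* Reference index: [Q] below does not depend on [i], so its real form [q] can be read off at
   [i0]. *)
pose i0 : 'I_m := Ordinal (ltnW m2).
pose C j k := [set u : n.-tuple R |
  Thhat (rosenblatt_inv n (F (ttheta j)) u) = k].
pose A i j k := [set y : n.-tuple R |
  Thhat (transf (F (theta i)) (F (ttheta j)) y) = k].
(* Chance of estimate [k] when uniform coordinates are fed to the inverse transform of pseudo
   parameter [j]. *)
pose Q j k := iter_integral (uniform_prob (@ltr01 R))
  (fun s : n.-tuple R => (\1_(C j k) s)%:E).
have mC j k : measurable (C j k).
  have := measurable_rosenblatt_inv n (F (ttheta j)) (mF _) (Fincr _) (F01 _)
    (Fsurj _).
  by move=> /(_ measurableT _ (mThhat k)); rewrite setTI.
have AE i j k : A i j k =
    (fun y : n.-tuple R => mk n (rosenblatt (F (theta i)) y)) @^-1` C j k.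
  by apply/seteqP; split=> y /=; rewrite /A /C /= transf_rosenblatt.
have mA i j k : measurable (A i j k).
  by rewrite AE -[X in measurable X]setTI; apply: measurable_rosenblatt.
(* Uniformity applied from the empty prefix, whose marginal is the total mass 1. *)
have PA i j k : P ([set w | Th w = i] `&` Y @^-1` A i j k) =
    ((p i)%:E * Q j k)%E.
  rewrite PThY//; congr (_ * _)%E.
  have margE0 : marg (dens (theta i)) [::] = 1%E.
    rewrite (margE n (dens (theta i)) n [::])// -(dens1 (theta i)); congr iint.
    by apply/funext => y; rewrite /= mk_id.
  have := iint_rosenblatt n (dens (theta i)) (F (theta i)) (mdens _) (dens0 _)
    (Fcdf _) (mF _) (Fincr _) (F01 _) (Fsurj _) n [::]
    (fun s => (\1_(C j k) s)%:E) erefl.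
  rewrite margE0 mul1e => iE.
  transitivity (iter_integral (uniform_prob (@ltr01 R))
    (fun s : n.-tuple R => (\1_(C j k) (mk n s))%:E)); last first.
    by congr iter_integral; apply/funext => s; rewrite mk_id.
  rewrite -iE; last 3 first.
  - exact/measurable_EFinP/measurable_indic.
  - by move=> y; rewrite lee_fin.
  - exact: ltry.
  congr iint; apply/funext => y; rewrite /= mk_id AE EFinM.
  by rewrite !indicE /= /in_mem.
have mTY i j k : measurable ([set w | Th w = i] `&` Y @^-1` A i j k).
  by apply: measurableI => //; rewrite -[X in measurable X]setTI; exact: mY.
pose q j k := fine (P ([set w | Th w = i0] `&` Y @^-1` A i0 j k)) / p i0.
have QE j k : Q j k = (q j k)%:E.
  apply: mule_EFin_eq; first by rewrite gt_eqF.
  by rewrite -PA fineK// fin_num_measure.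
have q0 j k : 0 <= q j k by rewrite divr_ge0// ?fine_ge0// ltW.
(* The estimates computed with parameters frozen at [i0] and [j] partition the event [Th = i0], of
   probability [p i0]. *)
have sq j : \sum_k q j k = 1.
  have := measure_level_sets (fun w =>
    Thhat (transf (F (theta i0)) (F (ttheta j)) (Y w))) P [set w | Th w = i0]
    (mTY i0 j).
  rewrite PTh; under eq_bigr do rewrite (PA i0 j) QE -EFinM.
  rewrite sumEFin -mulr_sumr => -[] /eqP.
  by rewrite -{1}(mulr1 (p i0)) eq_sym => /eqP /mulfI; apply; rewrite gt_eqF.
set E := [set w | Th w != _].
have mTTY i j k : measurable ([set w | Th w = i] `&` [set w | Tht w = j] `&`
    Y @^-1` A i j k).
  by apply: measurableI; [exact: measurableI|
    rewrite -[X in measurable X]setTI; exact: mY].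
(* On a cell the parameters of [transf] are constant, so the cell lies inside the error event if [k]
   differs from [i] and outside it otherwise. *)
have EE i j k : (E `&` [set w | Th w = i] `&` [set w | Tht w = j]) `&`
    [set w | Thhat (transf (F (theta i)) (F (ttheta j)) (Y w)) = k] =
    if k != i then [set w | Th w = i] `&` [set w | Tht w = j] `&` Y @^-1` A i j k
    else set0.
  case: eqVneq => [->|ki] /=; apply/seteqP; split=> w //=.
    by move=> [[[+ Ti] Tj] kE]; rewrite /E /= Ti Tj kE eqxx.
  - by move=> [[[_ Ti] Tj] kE].
  - move=> [[Ti Tj] kE]; do !split => //.
    by rewrite /E /= Ti Tj kE eq_sym.
have mEE i j k : measurable ((E `&` [set w | Th w = i] `&` [set w | Tht w = j]) `&`
    [set w | Thhat (transf (F (theta i)) (F (ttheta j)) (Y w)) = k]).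
  by rewrite EE; case: ifP => _.
have mE2 i j : measurable (E `&` [set w | Th w = i] `&` [set w | Tht w = j]).
  exact: measurable_level_sets _ _ (mEE i j).
have mE1 i : measurable (E `&` [set w | Th w = i]).
  exact: measurable_level_sets _ _ (mE2 i).
(* Conditional independence, divided by [p i > 0], makes [Pr j i] a factor. *)
have PTTY i j k : P ([set w | Th w = i] `&` [set w | Tht w = j] `&`
    Y @^-1` A i j k) = (p i * Pr j i * q j k)%:E.
  have := Pindep i j _ (mA i j k).
  rewrite PTh PThTht PA QE -!EFinM muleC => /mule_EFin_eq ->.
    by congr EFin; field; rewrite gt_eqF.
  by rewrite gt_eqF.
have PE : P E = (\sum_(i < m) \sum_(j < mt) \sum_(k < m | k != i)
    p i * Pr j i * q j k)%:E.
  rewrite (measure_level_sets Th P _ mE1) -sumEFin; apply: eq_bigr => i _.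
  rewrite (measure_level_sets Tht P _ (mE2 i)) -sumEFin; apply: eq_bigr => j _.
  rewrite (measure_level_sets _ P _ (mEE i j)) -sumEFin [RHS]big_mkcond/=.
  apply: eq_bigr => k _; rewrite EE; case: ifP => _; last exact: measure0.
  exact: PTTY.
have l2 : 0 < log2 m%:R :> R by rewrite divr_gt0 ?ln_gt0 ?ltr1n.
rewrite PE lee_fin ler_pdivrMr// mulrC.
(* Replacing the mutual information by its upper bound [I0] only lowers the left side. *)
apply: le_trans (fano_kernel R m mt p Pr q (ltnW m2) p0 sp Pr0 sPr q0 sq).
by rewrite lerB// lerB.
Qed.
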